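(* Let $w\in F_{\mathrm{odd}}$ have even rank. Then the rooted tree $F_{\mathrm{odd}}^w$ has the following structure: its root $w$ has exactly one child, $1w$; the node $1w$ has exactly two children, $11w$ and $2w$; the subtree of $F_{\mathrm{odd}}^w$ rooted at $11w$ is $F_{\mathrm{odd}}\,11w$, and the subtree rooted at $2w$ is $F_{\mathrm{odd}}\,2w$. Here, for a word $x$, $F_{\mathrm{odd}}\,x$ denotes the tree with vertex set $\{ux : u\in F_{\mathrm{odd}}\}$ in which $ux$ and $u'x$ are adjacent iff $u$ and $u'$ are adjacent in $F_{\mathrm{odd}}$ (a copy of $F_{\mathrm{odd}}$ with each label $u$ replaced by the concatenation $ux$).
   Context: For $n\ge 0$, let $F(n)$ be the set of all words $w=x_1\dotsb x_l$ with each $x_i\in\{1,2\}$ and $\sum_i x_i=n$; the rank of such $w$ is $n$, and $F=\coprod_{n\ge0}F(n)$ ($F(0)$ contains only the empty word $\emptyset$). The Young–Fibonacci graph has vertex set $F$, with an edge between $v\in F(n)$ and $w\in F(n+1)$ (written $v\in w^-$, $w\in v^+$; $w$ covers $v$) iff either (1) $v$ is obtained from $w$ by changing into a $1$ some $2$ of $w$ that has no $1$ to its left, or (2) $v$ is obtained from $w$ by removing its leftmost $1$. The $f$-statistic is defined by $f_\emptyset=1$ and $f_w=\sum_{v\in w^-}f_v$. A word $w$ is odd if $f_w$ is odd; $F_{\mathrm{odd}}$ is the subgraph of the Young–Fibonacci graph induced by the odd words; it is a tree rooted at $\emptyset$. For $w\in F_{\mathrm{odd}}$, $F_{\mathrm{odd}}^w$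 denotes the induced subtree rooted at $w$ consisting of those odd words $v$ that are connected to $w$ by a saturated chain $w=v_0,v_1,\dots,v_s=v$ (each $v_{j+1}$ covering $v_j$) with all $v_j\in F_{\mathrm{odd}}$. *)

(* Defs.v *)
From HB Require Import structures.
From mathcomp Require Import all_boot.
Set Implicit Arguments. Unset Strict Implicit. Unset Printing Implicit Defensive.

Record graph (T : Type) := Graph {
  vert : T -> Prop;
  adj : T -> T -> Prop
}.

Definition graph_eq (T : Type) (G H : graph T) : Prop :=
  (forall v, vert G v <-> vert H v) /\ (forall u v, adj G u v <-> adj H u v).

Definition induced (T : Type) (G : graph T) (P : T -> Prop) : graph T :=
  {| vert := fun v => vert G v /\ P v;
     adj := fun u v => [/\ P u, P v & adj G u v] |}.

(* Prop-valued analogue of [path]: r x p_1, r p_1 p_2, and so on. *)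
Fixpoint chain (T : Type) (r : T -> T -> Prop) (x : T) (p : seq T) : Prop :=
  if p is y :: p' then r x y /\ chain r y p' else True.

Definition simple_path (T : eqType) (G : graph T) (x : T) (p : seq T) (y : T) :=
  [/\ vert G x, chain (adj G) x p, uniq (x :: p) & last x p = y].

Definition rooted_tree (T : eqType) (G : graph T) (r : T) : Prop :=
  vert G r /\
  forall x y, vert G x -> vert G y -> exists! p, simple_path G x p y.

(* In the tree G rooted at r, the node x lies on the path from r to y. *)
Definition descendant (T : eqType) (G : graph T) (r x y : T) : Prop :=
  exists2 p, simple_path G r p y & x \in r :: p.

Definition child (T : eqType) (G : graph T) (r x y : T) : Prop :=
  adj G x y /\ descendant G r x y.

Definition subtree (T : eqType) (G : graph T) (r x : T) : graph T :=
  induced G (descendant G r x).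

Inductive letter := One | Two.

Definition letter_val (a : letter) : nat := if a is One then 1 else 2.

Definition letter_of_nat (n : nat) : letter := if n is 1 then One else Two.

Lemma letter_valK : cancel letter_val letter_of_nat. Proof. by case. Qed.

HB.instance Definition _ := Equality.copy letter (can_type letter_valK).

Definition word := seq letter.

Definition rank (w : word) : nat := sumn (map letter_val w).

(* [covers w v]: v is in w^-. *)
Definition covers (w v : word) : Prop :=
  (exists a b, [/\ w = a ++ Two :: b, One \notin a & v = a ++ One :: b]) \/
  (exists a b, [/\ w = a ++ One :: b, One \notin a & v = a ++ b]).

Lemma covers_rank (w v : word) : covers w v -> rank w = (rank v).+1.
Proof.
by case=> -[a [b [-> _ ->]]]; rewrite /rank !map_cat !sumn_cat /= ?addnS.
Qed.

Definition YF : graph word :=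
  {| vert := fun _ => True; adj := fun v w => covers w v \/ covers v w |}.

(* The set w^- as a duplicate-free list; see [mem_down] and [uniq_down]. *)
Fixpoint down (w : word) : seq word :=
  match w with
  | [::] => [::]
  | One :: u => [:: u]
  | Two :: u => (One :: u) :: map (cons Two) (down u)
  end.

Lemma mem_down (w v : word) : v \in down w <-> covers w v.
Proof.
elim: w v => [|[] w IH] v /=.
- by split=> // -[] [[|? ?] [? []]].
- rewrite inE; split=> [/eqP->|].
    by right; exists [::], w.
  case=> -[[|[] a] [b []]] //=; first by move=> [->] _ ->.
- rewrite inE; split.
    case/orP=> [/eqP->|/mapP[u /IH Hu ->]]; first by left; exists [::], w.
    by case: Hu => -[a [b [-> Ha ->]]]; [left|right]; exists (Two :: a), b;
      rewrite ?inE.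
  case=> -[[|[] a] [b []]] //=.
  + by move=> [->] _ ->; rewrite eqxx.
  + move=> [Ew]; rewrite inE /= => Ha ->; apply/orP; right.
    apply/mapP; exists (a ++ One :: b) => //; apply/IH.
    by left; exists a, b.
  + move=> [Ew]; rewrite inE /= => Ha ->; apply/orP; right.
    apply/mapP; exists (a ++ b) => //; apply/IH.
    by right; exists a, b.
Qed.

Lemma uniq_down (w : word) : uniq (down w).
Proof.
elim: w => [|[] w IH] //=; rewrite map_inj_uniq ?IH ?andbT; last by move=> ? ? [].
by apply/mapP => -[].
Qed.

(* Recursion on the rank, which drops by one along each cover;
   [fstat0] and [fstatE] are the defining equations. *)
Fixpoint fstat_rec (n : nat) (w : word) : nat :=
  if n is n'.+1 then \sum_(v <- down w) fstat_rec n' v else 1.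

Definition fstat (w : word) : nat := fstat_rec (rank w) w.

Lemma fstat0 : fstat [::] = 1. Proof. by []. Qed.

Lemma fstatE (w : word) : w != [::] -> fstat w = \sum_(v <- down w) fstat v.
Proof.
move=> w0; have [n rw] : exists n, rank w = n.+1.
  by case: w w0 => [|[] w] // _; eexists.
rewrite /fstat rw /=; apply: eq_big_seq => v /mem_down/covers_rank.
by rewrite rw => -[->].
Qed.

Definition odd_word (w : word) : Prop := odd (fstat w).

Definition Fodd : graph word := induced YF odd_word.

Definition Fodd_from (w : word) : graph word :=
  induced Fodd (fun v =>
    exists s : seq word,
      [/\ chain (fun x y => covers y x) w s,
          forall x, x \in w :: s -> odd_word x & last w s = v]).

(* The copy of F_odd in which each label u is replaced by ux. *)
Definition Fodd_cat (x : word) : graph word :=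
  {| vert := fun v => exists2 u, vert Fodd u & v = u ++ x;
     adj := fun v v' => exists u u',
       [/\ v = u ++ x, v' = u' ++ x & adj Fodd u u'] |}.

(* Main.v *)
(** Since f(1u) = f(u) and f(2u) = (rank u + 1) f(u), a word is odd iff every
    letter 2 in it is followed by a suffix of even rank.  Hence a nonempty odd
    word has exactly one odd word below it, obtained by erasing a leading 1 or
    by turning a leading 2 into 1; this parent map makes each F_odd^w a tree.
    If x is odd of even rank, then ux is odd iff u is, and the parent map acts
    on ux as it does on u, so F_odd^x = F_odd x.  It remains to note that the
    subtree of F_odd^w at x is F_odd^x, for x = 11w and x = 2w. *)
Require Import Defs.
From mathcomp Require Import all_boot.
Set Implicit Arguments. Unset Strict Implicit. Unset Printing Implicit Defensive.


(** * Chains and the reversal of paths *)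

Lemma chain_cat (T : Type) (r : T -> T -> Prop) x p q :
  chain r x (p ++ q) <-> chain r x p /\ chain r (last x p) q.
Proof. by elim: p x => [|y p IH] x /=; [tauto | have := IH y; tauto]. Qed.

Lemma chain_sub (T : Type) (r r' : T -> T -> Prop) x p :
  (forall a b, r a b -> r' a b) -> chain r x p -> chain r' x p.
Proof. by move=> rr'; elim: p x => [|y p IH] x //= [/rr' ? /IH]. Qed.

(** A path is stored as its start [x] and the remaining vertices [p], so the reversed path starts at
    [last x p] and continues with [rev (belast x p)]. *)
Lemma last_rev_belast (T : Type) (x : T) p : last (last x p) (rev (belast x p)) = x.
Proof. by case: p => [|z p] //=; rewrite rev_cons last_rcons. Qed.

Lemma rev_belastK (T : Type) (x : T) p :
  rev (belast (last x p) (rev (belast x p))) = p.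
Proof.
suff [] : x :: rev (belast (last x p) (rev (belast x p))) = x :: p by [].
rewrite -{1}(last_rev_belast x p) -rev_rcons -lastI.
by rewrite -rev_rcons -lastI revK.
Qed.

Lemma chain_rev (T : Type) (r : T -> T -> Prop) x p :
  chain (fun a b => r b a) x p -> chain r (last x p) (rev (belast x p)).
Proof.
elim: p x => [|y p IH] x //= [rxy /IH c].
rewrite rev_cons -cats1; apply/chain_cat; split=> //=; split=> //.
by rewrite last_rev_belast.
Qed.

Lemma simple_path_rev (T : eqType) (G : graph T) x p y :
  (forall a b, adj G a b -> adj G b a) -> vert G y ->
  simple_path G x p y -> simple_path G y (rev (belast x p)) x.
Proof.
move=> symG vy [vx c u l]; split=> //.
- by rewrite -l; apply: chain_rev; apply: chain_sub c.
- by rewrite -l -rev_rcons rev_uniq -lastI.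
- by rewrite -l last_rev_belast.
Qed.

(** * Trees given by a parent map *)

Definition parent_step (T : eqType) (G : graph T) (r : T) (par : T -> T) (x y : T) :=
  [/\ vert G y, y != r & x = par y].

(** A certificate of being a tree: every edge joins a vertex to its parent, and [d], which drops at
    each step towards the root, rules out cycles and serves as induction measure. For the trees of
    odd words [d] is the rank. *)
Record parent_map (T : eqType) (G : graph T) (r : T) (par : T -> T)
    (d : T -> nat) : Prop := ParentMap {
  parent_root : vert G r;
  parent_vert : forall x, vert G x -> x != r -> vert G (par x);
  parent_lt : forall x, vert G x -> x != r -> d (par x) < d x;
  parent_adj : forall x y, adj G x y <-> [/\ vert G x, vert G y &
    parent_step G r par x y \/ parent_step G r par y x] }.

Lemma parent_map_sym (T : eqType) (G : graph T) r par d :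
  parent_map G r par d -> forall x y, adj G x y -> adj G y x.
Proof.
move=> Gp x y /(parent_adj Gp)[vx vy H]; apply/(parent_adj Gp); split=> //.
by tauto.
Qed.

Lemma parent_step_lt (T : eqType) (G : graph T) r par d x y :
  parent_map G r par d -> parent_step G r par x y -> d x < d y.
Proof. by move=> Gp [vy yr ->]; apply: (parent_lt Gp). Qed.

Lemma parent_step_adj (T : eqType) (G : graph T) r par d x y :
  parent_map G r par d -> parent_step G r par x y -> adj G x y.
Proof.
move=> Gp xy; apply/(parent_adj Gp); case: (xy) => vy yr Ex; split=> //; last by left.
by rewrite Ex; apply: (parent_vert Gp).
Qed.

(** Iterating [par] lowers [d] strictly and can stop only at [r]. *)
Lemma parent_root_lt (T : eqType) (G : graph T) r par d x :
  parent_map G r par d -> vert G x -> x != r -> d r < d x.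
Proof.
move=> Gp; move: {2}(d x).+1 (ltnSn (d x)) => n.
elim: n x => // n IH x lt_n vx xr.
have lt_x := parent_lt Gp vx xr.
have [<- //|px] := eqVneq (par x) r.
apply: ltn_trans (lt_x); apply: IH => //; last exact: (parent_vert Gp).
exact: leq_trans lt_x _.
Qed.

Lemma parent_chain_le (T : eqType) (G : graph T) r par d x s :
  parent_map G r par d -> chain (parent_step G r par) x s -> d x <= d (last x s).
Proof.
move=> Gp; elim: s x => [|y s IH] x //= [/(parent_step_lt Gp)/ltnW le_xy /IH].
exact: leq_trans.
Qed.

Lemma parent_chain_uniq (T : eqType) (G : graph T) r par d x s :
  parent_map G r par d -> chain (parent_step G r par) x s -> uniq (x :: s).
Proof.
move=> Gp; elim: s x => [|y s IH] x // [xy c]; rewrite cons_uniq (IH y) // andbT.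
apply/negP=> /splitPl E; move: xy c; case: E => p1 p2 Ex xy.
case/chain_cat=> /(parent_chain_le Gp); rewrite Ex leqNgt.
by rewrite (parent_step_lt Gp xy).
Qed.

(* Coming back down from a child would revisit its parent. *)
Lemma parent_chain_of_up (T : eqType) (G : graph T) r par d x y s :
  parent_map G r par d -> parent_step G r par x y ->
  chain (adj G) y s -> uniq [:: x, y & s] -> chain (parent_step G r par) y s.
Proof.
move=> Gp; elim: s x y => [|z s IH] x y xy //= [yz c] u.
have yz' : parent_step G r par y z.
  case/(parent_adj Gp): yz => _ _ [] // [_ _ zy]; case: xy u => _ _ ->.
  by rewrite -zy !inE eqxx orbT.
by split=> //; apply: IH yz' c _; case/andP: u.
Qed.

(** If the first step led to a child, the path could never turn back and would end at a vertex with
    [d] larger than at [x]. *)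
Lemma simple_path_head (T : eqType) (G : graph T) r par d x p y :
  parent_map G r par d -> simple_path G x p y -> x != y -> d y <= d x ->
  exists2 q, p = par x :: q & simple_path G (par x) q y.
Proof.
move=> Gp [vx + + <-]; case: p => [|z p] /=; first by rewrite eqxx.
move=> [xz c] u _ le; have /(parent_adj Gp)[_ vz [up|[_ xr Ez]]] := xz.
  have /(parent_chain_le Gp) := parent_chain_of_up Gp up c u.
  by move=> /leq_trans/(_ le); rewrite leqNgt (parent_step_lt Gp up).
exists p; rewrite -?Ez //; split=> //.
by case/andP: u.
Qed.

(** Induction on [d x + d y]: the endpoint with the larger [d] is replaced by its parent, through
    which every simple path must pass. *)
Lemma parent_map_rooted_tree (T : eqType) (G : graph T) r par d :
  parent_map G r par d -> rooted_tree G r.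
Proof.
move=> Gp; split=> [|x y]; first exact: (parent_root Gp).
move: {2}(d x + d y).+1 (ltnSn (d x + d y)) => n.
elim: n x y => // n IH x y.
(* Reversing paths exchanges the endpoints, so the larger [d] may be put at [x]. *)
wlog le_yx : x y / d y <= d x.
  case: (leqP (d y) (d x)) => [le|/ltnW le] W lt_n vx vy; first exact: W.
  have [|p [xp up]] := W y x le _ vy vx; first by rewrite addnC.
  exists (rev (belast y p)); split=> [|q xq].
    exact: simple_path_rev (parent_map_sym Gp) vx xp.
  rewrite (up _ (simple_path_rev (parent_map_sym Gp) vy xq)).
  by have [_ _ _ <-] := xq; rewrite rev_belastK.
move=> lt_n vx vy; have [->|xy] := eqVneq x y.
  exists [::]; split=> // -[|z q] // [_ _ + l].
  by rewrite cons_uniq -{1}l [last _ _]/= mem_last.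
have xr : x != r.
  apply: contraTneq le_yx => Ex; rewrite Ex -ltnNge.
  by apply: (parent_root_lt Gp) => //; rewrite -Ex eq_sym.
have lt_x := parent_lt Gp vx xr.
have [|p [xp up]] := IH (par x) y _ (parent_vert Gp vx xr) vy.
  by rewrite -ltnS; apply: leq_trans lt_n; rewrite ltnS ltn_add2r.
(* If the path from [par x] met [x], its remainder would be a simple path from [x] and so would
   return to [par x]. *)
have x_p : x \notin par x :: p.
  rewrite inE negb_or; apply/andP; split.
    by apply: contraTneq lt_x => <-; rewrite ltnn.
  apply/negP=> /splitPr E; case: E xp {up} => p1 p2 [_ c u l].
  have [|q Ep2 _] := @simple_path_head _ G r par d x p2 y Gp _ xy le_yx.
    split=> //; first by case/chain_cat: c => _ [].
      by move: u; rewrite -cat_cons cat_uniq => /and3P[].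
    by move: l; rewrite last_cat.
  by move: u; rewrite Ep2 /= mem_cat !inE eqxx !orbT.
exists (par x :: p); split=> [|q xq]; last first.
  by have [q' -> /up ->] := simple_path_head Gp xq xy le_yx.
case: xp => _ c u l; split=> //=; last by rewrite x_p.
split=> //; apply: (parent_map_sym Gp); exact: (parent_step_adj Gp).
Qed.

Lemma simple_path_root (T : eqType) (G : graph T) r par d p y :
  parent_map G r par d -> simple_path G r p y -> chain (parent_step G r par) r p.
Proof.
move=> Gp [_ + + _]; case: p => //= z p [rz c] u.
have up : parent_step G r par r z.
  by case/(parent_adj Gp): rz => _ _ [] // []; rewrite eqxx.
by split=> //; apply: parent_chain_of_up Gp up c u.
Qed.

(** A simple path from the root only moves away from it, so its part after [x] is a chain of parent
    steps. Conversely, such a chain extends the path from the root to [x]. *)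
Lemma descendantP (T : eqType) (G : graph T) r par d x y :
  parent_map G r par d -> vert G x ->
  descendant G r x y <-> exists2 s, chain (parent_step G r par) x s & last x s = y.
Proof.
move=> Gp vx; split=> [[p rp]|[s c l]].
  have c := simple_path_root Gp rp; case: rp => _ _ _ l.
  move=> /splitPl E; case: E c l => p1 p2 Ex.
  by case/chain_cat=> _; rewrite last_cat Ex => c l; exists p2.
have [_ /(_ _ _ (parent_root Gp) vx)[p [rp _]]] := parent_map_rooted_tree Gp.
have c' := simple_path_root Gp rp; case: rp => vr _ _ lx.
have cc : chain (parent_step G r par) r (p ++ s) by apply/chain_cat; rewrite lx.
exists (p ++ s); last by rewrite -cat_cons mem_cat -lx mem_last.
split=> //; last by rewrite last_cat lx.
  by apply: chain_sub cc => a b; apply: (parent_step_adj Gp).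
exact: parent_chain_uniq Gp cc.
Qed.

(** Of the neighbours of [x], the parent is not a descendant, since [d] is at least [d x] on
    descendants. *)
Lemma childP (T : eqType) (G : graph T) r par d x y :
  parent_map G r par d -> child G r x y <-> parent_step G r par x y.
Proof.
move=> Gp; split=> [[/(parent_adj Gp)[vx vy []//]]|xy].
  move=> /(parent_step_lt Gp) lt /(descendantP _ Gp vx)[s] /(parent_chain_le Gp).
  by move=> + E; rewrite E leqNgt lt.
have a := parent_step_adj Gp xy; split=> //.
by have /(parent_adj Gp)[vx _ _] := a; apply/(descendantP _ Gp vx); exists [:: y].
Qed.

(** * Odd words *)

Lemma rank_cons a u : rank (a :: u) = letter_val a + rank u. Proof. by []. Qed.

Lemma rank_cat u v : rank (u ++ v) = rank u + rank v.
Proof. by rewrite /rank map_cat sumn_cat. Qed.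

Lemma fstat_One u : fstat (One :: u) = fstat u.
Proof. by rewrite fstatE //= big_seq1. Qed.

(* The words below 2u are exactly those above u: 1u and the 2v with v below u. *)
Lemma fstat_Two u : fstat (Two :: u) = (rank u).+1 * fstat u.
Proof.
move: {2}(rank u).+1 (ltnSn (rank u)) => n; elim: n u => // n IH u lt_n.
rewrite fstatE //= big_cons big_map fstat_One mulSn; congr (_ + _).
case: (eqVneq u [::]) => [->|u0]; first by rewrite big_nil.
rewrite [in RHS]fstatE // big_distrr /=.
apply: eq_big_seq => v /mem_down/covers_rank E; rewrite E; apply: IH.
by rewrite -E.
Qed.

Lemma odd_word_One u : odd_word (One :: u) <-> odd_word u.
Proof. by rewrite /odd_word fstat_One. Qed.

Lemma odd_word_Two u : odd_word (Two :: u) <-> ~~ odd (rank u) /\ odd_word u.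
Proof. by rewrite /odd_word fstat_Two oddM /=; split=> [/andP|[-> ->]]. Qed.

(** Appending [x] changes the rank of each suffix of [u] by an even amount, so the parity condition
    at each 2 is preserved. *)
Lemma odd_word_cat u x :
  odd_word x -> ~~ odd (rank x) -> odd_word (u ++ x) <-> odd_word u.
Proof.
move=> ox ex; elim: u => [|[] u IH] /=; first by split.
  by have := (odd_word_One u, odd_word_One (u ++ x)); tauto.
have := (odd_word_Two u, odd_word_Two (u ++ x)).
by rewrite rank_cat oddD (negPf ex) addbF; tauto.
Qed.

(** The first entry of [down w], with a default at the empty word. *)
Definition parent (w : word) : word :=
  match w with
  | [::] => [::]
  | One :: u => u
  | Two :: u => One :: u
  end.

Lemma rank_parent w : w != [::] -> rank w = (rank (parent w)).+1.
Proof. by case: w => [|[] u]. Qed.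

Lemma odd_word_parent w : odd_word w -> odd_word (parent w).
Proof.
by case: w => [|[] u] //= => [/odd_word_One|/odd_word_Two[_ /odd_word_One]].
Qed.

Lemma covers_parent w : w != [::] -> covers w (parent w).
Proof. by case: w => [|[] u] // _; apply/mem_down; rewrite inE eqxx. Qed.

(* If 2u is odd then u has even rank, so 2v is even for all v below u. *)
Lemma odd_covers w v :
  odd_word w -> odd_word v -> covers w v -> w != [::] /\ v = parent w.
Proof.
case: w => [|[] u] ow ov /mem_down; rewrite //= inE.
  by move/eqP.
case/orP=> [/eqP //|/mapP[t /mem_down/covers_rank E Ev]].
case/odd_word_Two: ow => eu _; move: ov; rewrite Ev => /odd_word_Two[et _].
by move: eu; rewrite E /= negbK (negPf et).
Qed.

(** * The trees [Fodd_from w] and their parent map *)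

Lemma Fodd_from_odd w v : vert (Fodd_from w) v -> odd_word v.
Proof. by case=> -[]. Qed.

Lemma Fodd_from_self w : odd_word w -> vert (Fodd_from w) w.
Proof.
by move=> ow; split=> //; exists [::]; split=> // x; rewrite inE => /eqP->.
Qed.

Lemma Fodd_from_covers w x y :
  vert (Fodd_from w) x -> odd_word y -> covers y x -> vert (Fodd_from w) y.
Proof.
move=> [_ [s [c o l]]] oy yx; split=> //; exists (rcons s y).
rewrite last_rcons -cats1; split=> //; first by apply/chain_cat; rewrite l.
by move=> z; rewrite -cat_cons mem_cat mem_seq1 => /orP[/o|/eqP->].
Qed.

Lemma Fodd_from_up w y :
  vert (Fodd_from w) (parent y) -> odd_word y -> y != [::] -> vert (Fodd_from w) y.
Proof. by move=> vp oy y0; apply: Fodd_from_covers vp oy (covers_parent y0). Qed.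

(** By [odd_covers], each step of a saturated chain of odd words goes from [parent y] to [y]; this
    induction then replaces reasoning on chains. *)
Lemma Fodd_from_ind w (P : word -> Prop) :
  P w ->
  (forall y, vert (Fodd_from w) (parent y) -> P (parent y) ->
             odd_word y -> y != [::] -> P y) ->
  forall v, vert (Fodd_from w) v -> P v.
Proof.
move=> Pw Pup v [_ [s [c o <-]]].
have vw : vert (Fodd_from w) w by apply/Fodd_from_self/o/mem_head.
have H x : (forall z, z \in x :: s -> odd_word z) ->
    chain (fun a b => covers b a) x s -> P x -> vert (Fodd_from w) x -> P (last x s).
  elim: s x {c o} => [|y s IH] x //= o [yx c] Px vx.
  have oy : odd_word y by apply: o; rewrite !inE eqxx orbT.
  have [y0 Ex] := odd_covers oy (Fodd_from_odd vx) yx.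
  apply: IH c _ _; last exact: Fodd_from_covers vx oy yx.
    by move=> z zs; apply: o; rewrite inE zs orbT.
  by apply: Pup => //; rewrite -Ex.
exact: H.
Qed.

Lemma Fodd_from_rank w v : vert (Fodd_from w) v -> v != w -> rank w < rank v.
Proof.
move: v; apply: Fodd_from_ind => [|y _ IH _ y0 _]; first by rewrite eqxx.
rewrite (rank_parent y0) ltnS.
by case: (eqVneq (parent y) w) IH => [->|_ /(_ isT)/ltnW].
Qed.

Lemma Fodd_from_parent w v :
  vert (Fodd_from w) v -> v != w -> vert (Fodd_from w) (parent v).
Proof. by move: v; apply: Fodd_from_ind => //; rewrite eqxx. Qed.

Lemma Fodd_adj x y : adj Fodd x y <->
  [/\ odd_word x, odd_word y &
      (y != [::] /\ x = parent y) \/ (x != [::] /\ y = parent x)].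
Proof.
split=> [[ox oy [c|c]]|[ox oy H]]; split=> //.
- by left; apply: odd_covers.
- by right; apply: odd_covers.
- by case: H => -[n0 ->]; [left|right]; apply: covers_parent.
Qed.

Lemma Fodd_from_parent_map w :
  odd_word w -> parent_map (Fodd_from w) w parent rank.
Proof.
move=> ow.
have n0 x : vert (Fodd_from w) x -> x != w -> x != [::].
  by move=> vx xw; apply: contraTneq (Fodd_from_rank vx xw) => ->.
(* The root [w] is never the upper end of an edge of the tree: its parent has smaller rank than [w],
   hence lies outside. *)
have nw x y : vert (Fodd_from w) x -> vert (Fodd_from w) y -> y != [::] ->
    x = parent y -> y != w.
  move=> vx vy y0 Ex; apply/negP=> /eqP Ey.
  have lt : rank x < rank w by rewrite -Ey (rank_parent y0) Ex.
  have [E|/(Fodd_from_rank vx)] := eqVneq x w; first by rewrite E ltnn in lt.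
  by rewrite ltnNge (ltnW lt).
split.
- exact: Fodd_from_self.
- exact: Fodd_from_parent.
- by move=> x vx xw; rewrite (rank_parent (n0 _ vx xw)).
move=> x y; split=> [[Px Py /Fodd_adj[ox oy H]]|[vx vy H]].
  have vx : vert (Fodd_from w) x by split.
  have vy : vert (Fodd_from w) y by split.
  split=> //; case: H => -[e0 E]; [left|right]; split=> //.
    exact: (nw x y).
  exact: (nw y x).
case: (vx) (vy) => [[_ ox] Px] [[_ oy] Py]; split=> //; apply/Fodd_adj; split=> //.
by case: H => -[vz zw E]; [left|right]; split=> //; apply: n0.
Qed.

Lemma Fodd_from_trans w x y :
  vert (Fodd_from w) x -> vert (Fodd_from x) y -> vert (Fodd_from w) y.
Proof.
by move=> vx; move: y; apply: Fodd_from_ind => // y _; apply: Fodd_from_up.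
Qed.

(** Both sides are generated from [x] by the same parent steps; transitivity keeps those starting at
    [x] inside the tree of [w]. *)
Lemma Fodd_from_descendant w x y :
  odd_word w -> vert (Fodd_from w) x ->
  descendant (Fodd_from w) w x y <-> vert (Fodd_from x) y.
Proof.
move=> ow vx; have Gp := Fodd_from_parent_map ow.
split=> [/(descendantP _ Gp vx)[s c <-]|].
  have H z : chain (parent_step (Fodd_from w) w parent) z s ->
      vert (Fodd_from x) z -> vert (Fodd_from x) (last z s).
    elim: s z {c} => [|t s IH] z //= [[vt tw E] c] vz.
    apply: (IH t) => //; apply: Fodd_from_up; rewrite -?E //.
      exact: Fodd_from_odd vt.
    by apply: contraTneq (Fodd_from_rank vt tw) => ->.
  by apply: H c _; apply: Fodd_from_self; apply: Fodd_from_odd vx.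
move: y; apply: Fodd_from_ind => [|y vp /(descendantP _ Gp vx)[s c l] oy y0].
  by apply/(descendantP _ Gp vx); exists [::].
apply/(descendantP _ Gp vx); exists (rcons s y); last exact: last_rcons.
rewrite -cats1; apply/chain_cat; rewrite l; split=> //=; split=> //; split=> //.
  exact: Fodd_from_trans vx (Fodd_from_up vp oy y0).
(* [y] is not [w], because [parent y] already has rank at least that of [w]. *)
apply: contraTneq (introT eqP (rank_parent y0)) => Ey; rewrite {1}Ey neq_ltn; apply/orP; left.
have [->|] := eqVneq (parent y) w; first exact: ltnSn.
by move/(Fodd_from_rank (Fodd_from_trans vx vp))/leq_trans; apply; apply: leqnSn.
Qed.

(** * Comparison with the copies [Fodd_cat x] *)

Lemma Fodd_from_catP x y :
  odd_word x -> ~~ odd (rank x) ->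
  vert (Fodd_from x) y <-> exists2 u, odd_word u & y = u ++ x.
Proof.
move=> ox ex; split.
  move: y; apply: Fodd_from_ind => [|y _ [u ou E] oy y0]; first by exists [::].
  case: y y0 oy E => [|[] v] //= _ oy E.
    by exists (One :: u); rewrite ?E //; apply/odd_word_One.
  case: u ou E => [|[] u] //= ou E; last first.
    case: E => E; exists (Two :: u); rewrite ?E //.
    by apply/(odd_word_cat _ ox ex); rewrite /= -E.
  (* The one way to lose the suffix [x] is to turn its leading 1 into a 2, when [x] is [1v]. Then
     [v] has odd rank, so [2v] is not odd. *)
  by case/odd_word_Two: oy => ev _; move: ex; rewrite -E /= negbK (negPf ev).
case=> u + ->; elim: u => [|[] u IH] ou; first exact: Fodd_from_self.
  apply: Fodd_from_up => //; last by apply/(odd_word_cat _ ox ex).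
  by apply: IH; apply/odd_word_One.
have [_ ou'] := (odd_word_Two u).1 ou.
apply: Fodd_from_up => //; last by apply/(odd_word_cat _ ox ex).
(* The word [2ux] is reached from [ux] in two steps, through [1ux]. *)
apply: Fodd_from_up => //; first exact: IH.
by apply/odd_word_One/(odd_word_cat _ ox ex).
Qed.

Lemma parent_cat u x : u != [::] -> parent (u ++ x) = parent u ++ x.
Proof. by case: u => [|[] u]. Qed.

Lemma Fodd_adj_cat u v x :
  odd_word x -> ~~ odd (rank x) -> adj Fodd (u ++ x) (v ++ x) <-> adj Fodd u v.
Proof.
move=> ox ex.
have step a b : (b ++ x != [::] /\ a ++ x = parent (b ++ x)) <->
                (b != [::] /\ a = parent b).
  split=> -[b0 E]; last by rewrite E parent_cat //; case: (b) b0.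
  (* For empty [b], [a ++ x] would be the parent of [x], but its rank is not below that of [x]. *)
  have bn : b != [::].
    apply: contraTneq (introT eqP (rank_parent b0)) => Eb.
    by rewrite -E Eb /= rank_cat -addSn -{1}[rank x]add0n eqn_add2r.
  split=> //; move: E; rewrite parent_cat // => E.
  have /addIn sz : size a + size x = size (parent b) + size x by rewrite -!size_cat E.
  by move/eqP: E; rewrite eqseq_cat // => /andP[/eqP].
have Iu := odd_word_cat u ox ex; have Iv := odd_word_cat v ox ex.
have S1 := step u v; have S2 := step v u.
by split=> /Fodd_adj[a b c]; apply/Fodd_adj; split; tauto.
Qed.

(** The descendants of [x] form the tree [Fodd_from x], whose vertices are the words [u ++ x] with
    [u] odd; cancelling [x] preserves adjacency. *)
Lemma subtree_Fodd_from w x :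
  odd_word w -> vert (Fodd_from w) x -> ~~ odd (rank x) ->
  graph_eq (subtree (Fodd_from w) w x) (Fodd_cat x).
Proof.
move=> ow vx ex; have ox := Fodd_from_odd vx.
have D y := Fodd_from_descendant y ow vx.
have C y := Fodd_from_catP y ox ex.
have V y := Fodd_from_trans (y := y) vx.
split=> [v|a b].
  split=> [[_ /D/C]|[u [_ ou] ->]]; first by case=> u ou ->; exists u.
  have vu : vert (Fodd_from x) (u ++ x) by apply/C; exists u.
  by split; [apply: V | apply/D].
split=> [[/D/C[u ou ->] /D/C[v ov ->] [_ _ /(Fodd_adj_cat _ _ ox ex) uv]]|].
  by exists u, v.
case=> u [v [-> -> uv]]; have /Fodd_adj[ou ov _] := uv.
have vu : vert (Fodd_from x) (u ++ x) by apply/C; exists u.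
have vv : vert (Fodd_from x) (v ++ x) by apply/C; exists v.
split; [exact/D | exact/D |].
by case: (V _ vu) (V _ vv) => _ Pu [_ Pv]; split=> //; apply/Fodd_adj_cat.
Qed.

Theorem mainTheorem5 (w : word) (w_odd : vert Fodd w) (w_even : ~~ odd (rank w)) :
  [/\ rooted_tree (Fodd_from w) w,
      forall v : word, child (Fodd_from w) w w v <-> v = One :: w,
      forall v : word, child (Fodd_from w) w (One :: w) v <->
                v = One :: One :: w \/ v = Two :: w,
      graph_eq (subtree (Fodd_from w) w (One :: One :: w))
               (Fodd_cat (One :: One :: w)) &
      graph_eq (subtree (Fodd_from w) w (Two :: w)) (Fodd_cat (Two :: w))].
Proof.
have ow : odd_word w by case: w_odd.
have Gp := Fodd_from_parent_map ow.
have vw := Fodd_from_self ow.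
have o1 : odd_word (One :: w) by apply/odd_word_One.
have v1 : vert (Fodd_from w) (One :: w) by apply: Fodd_from_up.
have v11 : vert (Fodd_from w) [:: One, One & w].
  by apply: Fodd_from_up => //; apply/odd_word_One.
have v2 : vert (Fodd_from w) (Two :: w).
  by apply: Fodd_from_up => //; apply/odd_word_Two.
have ne a b : rank a < rank b -> b != a by apply: contraTneq => ->; rewrite ltnn.
split.
- exact: parent_map_rooted_tree Gp.
- move=> v; split=> [/(childP _ _ Gp)[/Fodd_from_odd ov + E]|->]; last first.
    by apply/(childP _ _ Gp); split=> //; apply: ne; rewrite rank_cons ltnS.
  case: v ov E => [|[] v] ov /= E; rewrite E ?eqxx // => _.
  (* A second child [2v] would require [w] to be [1v]; then [v] has odd rank and [2v] is not odd. *)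
  by case/odd_word_Two: ov => ev _; move: w_even; rewrite E /= negbK (negPf ev).
- move=> v; split=> [/(childP _ _ Gp)[_ _]|E].
    by case: v => [|[] v] //= => [->|[->]]; [left|right].
  apply/(childP _ _ Gp); case: E => ->; split=> //; apply: ne.
    by rewrite !rank_cons ltnS leqnSn.
  by rewrite rank_cons ltnS leqnSn.
- by apply: subtree_Fodd_from => //; rewrite !rank_cons /= negbK.
- by apply: subtree_Fodd_from => //; rewrite !rank_cons /= negbK.
Qed.
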